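(* Let $(X_1,\mathcal A_1)$ and $(X_2,\mathcal A_2)$ be measurable spaces and $k_1,k_2$ be bounded, measurable kernels on $X_1$ and $X_2$, with reproducing kernel Hilbert spaces $H_1$ and $H_2$, respectively. Let $H$ be the reproducing kernel Hilbert space of the kernel $k:=k_1\cdot k_2$ on $X_1\times X_2$, i.e. $k((x_1,x_2),(x_1',x_2'))=k_1(x_1,x_1')k_2(x_2,x_2')$. Then, for all $\mu_1\in\mathcal M(X_1)$ and $\mu_2\in\mathcal M(X_2)$ we have $$\|\mu_1\otimes\mu_2\|_H=\|\mu_1\|_{H_1}\cdot\|\mu_2\|_{H_2}.$$ In particular, if $\dim\mathcal M(X_1)\ge2$, $\dim\mathcal M(X_2)\ge2$, and $k$ is characteristic, then $k_1$ and $k_2$ are strictly integrally positive definite with respect to $\mathcal M(X_1)$ and $\mathcal M(X_2)$, respectively.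
   Context: A kernel on $X$ is a symmetric positive definite function $k:X\times X\to\mathbb R$ (i.e. $\sum_{i,j}a_ia_jk(x_i,x_j)\ge0$ for all finite choices). $\mathcal M(X)$ is the space of finite signed measures on a measurable space $X$ and $\mathcal M_1(X)$ the set of probability measures; $X_1\times X_2$ carries the product $\sigma$-algebra. For a bounded measurable kernel $k$ with RKHS $H$, the kernel embedding is $\Phi:\mathcal M(X)\to H$, $\Phi(\mu):=\int_X k(\cdot,x)\,\mathrm d\mu(x)$ (Pettis integral), and $\|\mu\|_H:=\|\Phi(\mu)\|_H$. A bounded measurable kernel is called characteristic if $\Phi$ restricted to $\mathcal M_1(X)$ is injective. It is strictly integrally positive definite with respect to $\mathcal M\subset\mathcal M(X)$ if $\|\mu\|_H^2=\int\int k(x,x')\,\mathrm d\mu(x)\,\mathrm d\mu(x')>0$ for all $\mu\in\mathcal M$ with $\mu\ne0$. *)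

(* Defs.v *)
From HB Require Import structures.
From mathcomp Require Import all_boot all_order all_algebra.
From mathcomp Require Import all_classical all_reals all_analysis.
From mathcomp Require Import ring.

Set Implicit Arguments.
Unset Strict Implicit.
Unset Printing Implicit Defensive.

Import Order.TTheory GRing.Theory Num.Theory.
Import numFieldNormedType.Exports.

Local Open Scope classical_set_scope.
Local Open Scope ring_scope.

Section kernels.
Context (R : realType) (X : Type).

Definition pd_kernel (k : X -> X -> R) : Prop :=
  (forall x y, k x y = k y x) /\
  (forall (n : nat) (a : 'I_n -> R) (x : 'I_n -> X),
     0 <= \sum_(i < n) \sum_(j < n) a i * a j * k (x i) (x j)).

Definition kernel_bounded (k : X -> X -> R) : Prop :=
  exists M : R, forall x y, `|k x y| <= M.

(* A reproducing kernel Hilbert space of [k]: a complete normed space whose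
   norm comes from an inner product, whose elements are functions on [X] via
   the injective linear map [rkhs_eval], which contains every [k (_, x)] and in
   which [f x = <f, k (_, x)>].  Such a space is unique up to an isometry
   compatible with [rkhs_eval]. *)
Record rkhs (k : X -> X -> R) := RKHS {
  rkhs_space :> completeNormedModType R;
  rkhs_dot : {dot rkhs_space for idfun};
  rkhs_normE : forall f : rkhs_space, `|f| ^+ 2 = rkhs_dot f f;
  rkhs_eval : {linear rkhs_space -> (X -> R^o)};
  rkhs_eval_inj : injective rkhs_eval;
  rkhs_feature : X -> rkhs_space;
  rkhs_featureE : forall x, rkhs_eval (rkhs_feature x) = k ^~ x;
  rkhs_reproducing : forall (f : rkhs_space) (x : X),
    rkhs_eval f x = rkhs_dot f (rkhs_feature x) }.

End kernels.

Definition kernel_measurable (R : realType) d (X : measurableType d)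
    (k : X -> X -> R) : Prop :=
  measurable_fun [set: X * X] (fun z => k z.1 z.2).

Definition prod_kernel (R : realType) (X1 X2 : Type)
    (k1 : X1 -> X1 -> R) (k2 : X2 -> X2 -> R) : X1 * X2 -> X1 * X2 -> R :=
  fun x y => k1 x.1 y.1 * k2 x.2 y.2.

(* Finite signed measures are the library's charges.  A charge is a function on
   all sets whose values off the sigma-algebra are irrelevant, so charges are
   compared on measurable sets only. *)
Section charges.
Context (R : realType) d (T : measurableType d).
Implicit Type nu : {charge set T -> \bar R}.

Definition is_zero_charge nu : Prop :=
  forall A, measurable A -> nu A = 0%E.

(* The space of finite signed measures contains [n] linearly independent
   elements. *)
Definition charge_dim_ge (n : nat) : Prop :=
  exists nu : 'I_n -> {charge set T -> \bar R},
    forall c : 'I_n -> R,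
      (forall A, measurable A -> (\sum_(i < n) (c i)%:E * nu i A = 0)%E) ->
      forall i, c i = 0.

Definition hahn_pos nu : set T := sval (cid (Hahn_decomposition nu)).

Definition hahn_neg nu : set T :=
  sval (cid (svalP (cid (Hahn_decomposition nu)))).

Lemma hahnP nu : hahn_decomposition nu (hahn_pos nu) (hahn_neg nu).
Proof. exact: (svalP (cid (svalP (cid (Hahn_decomposition nu))))). Qed.

Definition charge_pos nu : {finite_measure set T -> \bar R} :=
  jordan_pos (hahnP nu).

Definition charge_neg nu : {finite_measure set T -> \bar R} :=
  jordan_neg (hahnP nu).

Definition charge_integrable nu (f : T -> R) : Prop :=
  (charge_variation (hahnP nu)).-integrable [set: T] (EFin \o f).

Definition charge_integral nu (f : T -> R) : R :=
  (\int[charge_pos nu]_x f x - \int[charge_neg nu]_x f x)%R.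

Definition is_pettis_integral (V : normedModType R) nu (f : T -> V) (v : V) :
    Prop :=
  forall l : {linear V -> R^o}, continuous l ->
    charge_integrable nu (l \o f) /\ l v = charge_integral nu (l \o f).

End charges.

Section product_charge.
Context (R : realType) d1 d2 (T1 : measurableType d1) (T2 : measurableType d2).
Local Open Scope ereal_scope.

Section finite_product.
Variables (m1 : {finite_measure set T1 -> \bar R}).
Variables (m2 : {finite_measure set T2 -> \bar R}).

Definition finite_product : set (T1 * T2)%type -> \bar R := m1 \x m2.

Let finite_product0 : finite_product set0 = 0.
Proof. exact: (measure0 (m1 \x m2)). Qed.

Let finite_product_fin A : measurable A -> finite_product A \is a fin_num.
Proof.
move=> mA; rewrite ge0_fin_numE; last exact: (measure_ge0 (m1 \x m2)).
have : (m1 \x m2) A <= (m1 \x m2) setT by apply: le_measure; rewrite ?inE.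
move=> /le_lt_trans; apply.
rewrite -setXTT product_measure1E// ltey_eq fin_numM//; exact: fin_num_measure.
Qed.

Let finite_product_sigma_additive : semi_sigma_additive finite_product.
Proof. exact: (@measure_semi_sigma_additive _ _ _ (m1 \x m2)). Qed.

HB.instance Definition _ := isCharge.Build _ _ _ finite_product
  finite_product0 finite_product_fin finite_product_sigma_additive.

End finite_product.

(* The product of signed measures, by bilinearity from their Jordan
   decompositions; it is determined by [prod_chargeE] below. *)
Definition prod_charge (nu1 : {charge set T1 -> \bar R})
    (nu2 : {charge set T2 -> \bar R}) : {charge set (T1 * T2)%type -> \bar R} :=
  cadd
    (cadd (finite_product (charge_pos nu1) (charge_pos nu2))
          (finite_product (charge_neg nu1) (charge_neg nu2)))
    (copp (cadd (finite_product (charge_pos nu1) (charge_neg nu2))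
                (finite_product (charge_neg nu1) (charge_pos nu2)))).

Lemma charge_jordanE d (T : measurableType d) (nu : {charge set T -> \bar R}) A :
  measurable A -> nu A = charge_pos nu A - charge_neg nu A.
Proof. by move=> mA; rewrite (jordan_decomp (hahnP nu) mA) /cadd/= cscaleN1. Qed.

Lemma prod_chargeE (nu1 : {charge set T1 -> \bar R})
    (nu2 : {charge set T2 -> \bar R}) A B :
  measurable A -> measurable B ->
  prod_charge nu1 nu2 (A `*` B) = nu1 A * nu2 B.
Proof.
move=> mA mB; rewrite (charge_jordanE nu1 mA) (charge_jordanE nu2 mB).
transitivity
  (charge_pos nu1 A * charge_pos nu2 B + charge_neg nu1 A * charge_neg nu2 B -
   (charge_pos nu1 A * charge_neg nu2 B + charge_neg nu1 A * charge_pos nu2 B)).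
  by rewrite -!product_measure1E.
have f (e : measure_display) (T : measurableType e)
  (m : {finite_measure set T -> \bar R}) C :
  measurable C -> exists r : R, m C = r%:E.
  by move=> mC; exists (fine (m C)); rewrite fineK// fin_num_measure.
have [p1 ->] := f _ _ (charge_pos nu1) A mA.
have [n1 ->] := f _ _ (charge_neg nu1) A mA.
have [p2 ->] := f _ _ (charge_pos nu2) B mB.
have [n2 ->] := f _ _ (charge_neg nu2) B mB.
rewrite -?EFinM -?EFinD -?EFinM -?EFinD; congr EFin; ring.
Qed.

End product_charge.

Section kernel_embedding.
Context (R : realType) d (X : measurableType d) (k : X -> X -> R) (H : rkhs k).

(* The default value [0] plays no role for a bounded measurable [k], whose
   Pettis integral exists and is unique. *)
Definition kernel_embedding (nu : {charge set X -> \bar R}) : H :=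
  xget 0 [set h : H | is_pettis_integral nu (rkhs_feature H) h].

Definition embedding_norm (nu : {charge set X -> \bar R}) : R :=
  `|kernel_embedding nu|.

Definition characteristic_kernel : Prop :=
  forall P Q : probability X R,
    kernel_embedding (charge_of_finite_measure P) =
    kernel_embedding (charge_of_finite_measure Q) ->
    forall A, measurable A -> P A = Q A.

Definition strictly_integrally_pd (M : set (charge X R)) : Prop :=
  forall nu, M nu -> ~ is_zero_charge nu ->
    embedding_norm nu ^+ 2 =
      charge_integral nu (fun x => charge_integral nu (fun x' => k x x')) /\
    0 < charge_integral nu (fun x => charge_integral nu (fun x' => k x x')).

End kernel_embedding.

(* Main.v *)
(** In an RKHS [H], <f, Phi nu> is the integral of f against nu. Hence Phi nu is
    the function x |-> \int k(., x) dnu and its squared norm is the integral of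
    Phi nu against nu. The Pettis integral Phi nu exists by the Riesz theorem,
    once every function of the RKHS is known to be measurable. For a product
    kernel, Phi (mu1 (x) mu2) = Phi mu1 (x) Phi mu2 as functions, and Fubini
    gives the product formula.

    If ||mu1|| = 0 with mu1 nonzero, pair mu1 with a nonzero mu2 of total mass 0,
    which exists in dimension at least 2. Then mu1 (x) mu2 has mass 0 and norm 0,
    so the normalisations of its positive and negative parts are probability
    measures with the same embedding. They coincide when k is characteristic,
    forcing mu1 (x) mu2 = 0, a contradiction. *)
From HB Require Import structures.
Require Import Defs.
From mathcomp Require Import all_boot all_order all_algebra.
From mathcomp Require Import all_classical all_reals all_analysis.
From mathcomp Require Import measurable_realfun ring lra.

Set Implicit Arguments.
Unset Strict Implicit.
Unset Printing Implicit Defensive.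

Import Order.TTheory GRing.Theory Num.Theory.
Import numFieldNormedType.Exports.

Local Open Scope classical_set_scope.
Local Open Scope ring_scope.

(** * Hilbert space geometry: Cauchy-Schwarz and the Riesz representation *)

Section hilbert.
Context (R : realType) (V : completeNormedModType R).
Variable dot : {dot V for idfun}.
Hypothesis normE : forall f : V, `|f| ^+ 2 = dot f f.

Let dotC u v : dot u v = dot v u.
Proof. by rewrite (@hermC _ false) expr0 mul1r. Qed.

Let dotDl u v w : dot (u + v) w = dot u w + dot v w.
Proof. exact: linearDl. Qed.

Let dotZl a u w : dot (a *: u) w = a * dot u w.
Proof. by rewrite linearZl_LR. Qed.

Let dotDr u v w : dot u (v + w) = dot u v + dot u w.
Proof. by rewrite linearDr. Qed.

Let dotZr a u w : dot u (a *: w) = a * dot u w.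
Proof. by rewrite linearZr_LR. Qed.

Lemma dot_normD u v : `|u + v| ^+ 2 = `|u| ^+ 2 + 2 * dot u v + `|v| ^+ 2.
Proof. rewrite !normE dotDl !dotDr (dotC v u); ring. Qed.

Lemma dot_ext u v : (forall f, dot f u = dot f v) -> u = v.
Proof.
move=> uv; apply/eqP; rewrite -subr_eq0 -normr_eq0 -sqrf_eq0 normE.
by rewrite -scaleN1r dotDr dotZr uv mulN1r subrr.
Qed.

Lemma cauchy_schwarz u v : `|dot u v| <= `|u| * `|v|.
Proof.
have [->|v0] := eqVneq v 0; first by rewrite linear0r !normr0 mulr0.
have v2 : 0 < `|v| ^+ 2 by rewrite exprn_gt0// normr_gt0.
(* Expand the squared norm of [u] minus its orthogonal projection onto the line of [v]. *)
have := sqr_ge0 `|u - (dot u v / `|v| ^+ 2) *: v|.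
rewrite -scaleNr dot_normD dotZr normrZ exprMn normrN real_normK ?num_real//.
have -> : `|u| ^+ 2 + 2 * (- (dot u v / `|v| ^+ 2) * dot u v) +
  (dot u v / `|v| ^+ 2) ^+ 2 * `|v| ^+ 2 =
  `|u| ^+ 2 - dot u v ^+ 2 / `|v| ^+ 2 by field; rewrite normr_eq0.
rewrite subr_ge0 ler_pdivrMr// -exprMn => h.
by rewrite -(@ler_pXn2r _ 2)// ?nnegrE// ?mulr_ge0// real_normK ?num_real.
Qed.

Lemma cvg_dotl (u : V^nat) v w :
  u @ \oo --> v -> dot (u n) w @[n --> \oo] --> dot v w.
Proof.
move=> uv; apply/cvgrPdist_lt => e e0.
(* Adding 1 allows division by this bound even when [w = 0]. *)
have w0 : 0 < `|w| + 1 by rewrite ltr_wpDl.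
have /cvgrPdist_lt/(_ (e / (`|w| + 1))) := uv.
rewrite divr_gt0// => /(_ isT); apply: filterS => n.
rewrite ltr_pdivlMr// => uvn; apply: le_lt_trans uvn.
have -> : dot v w - dot (u n) w = dot (v - u n) w.
  by rewrite linearBl.
by rewrite (le_trans (cauchy_schwarz _ _))// ler_wpM2l// lerDl.
Qed.

(** The codomain [R^o] lets [dot u] carry a structure of linear form, so that it can serve as a test
    form for Pettis integrals. *)
Definition dot_form (u v : V) : R^o := dot u v.

Lemma dot_form_linear u : linear (dot_form u).
Proof. by move=> a v w; rewrite /dot_form dotDr dotZr. Qed.

HB.instance Definition _ u :=
  GRing.isLinear.Build R V R^o *:%R (dot_form u) (dot_form_linear u).

Lemma dot_form_continuous u : continuous (dot_form u).
Proof.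
apply: bounded_linear_continuous; apply/linear_boundedP.
exists `|u|; split; first exact: num_real.
move=> r ur v; rewrite (le_trans (cauchy_schwarz _ _))// ler_wpM2r//.
exact: ltW.
Qed.

(* The representing vector minimises [`|f| ^+ 2 - 2 * l f] over [M]; a
   minimising sequence is Cauchy by the parallelogram identity. *)
Lemma riesz_subspace (M : set V) (l : V -> R) (C : R) :
  M 0 -> (forall a u v, M u -> M v -> M (a *: u + v)) ->
  (forall (u : V^nat) v, (forall n, M (u n)) -> u @ \oo --> v -> M v) ->
  (forall a u v, l (a *: u + v) = a * l u + l v) ->
  (forall v, `|l v| <= C * `|v|) ->
  exists2 m, M m & forall f, M f -> l f = dot f m.
Proof.
move=> M0 Mlin Mcl llin lC.
pose J (f : V) : R := `|f| ^+ 2 - 2 * l f.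
have lD u v : l (u + v) = l u + l v by rewrite -[u]scale1r llin mul1r scale1r.
have l0 : l 0 = 0 by have := lD 0 0; rewrite addr0; lra.
have lZ a u : l (a *: u) = a * l u by rewrite -[a *: u]addr0 llin l0 addr0.
(* [J f] is at least [|f| ^+ 2 - 2 * C * |f|]; completing the square gives the bound. *)
have Jlb f : - C ^+ 2 <= J f.
  rewrite /J; have := lC f; have := ler_norm (l f).
  have := sqr_ge0 (`|f| - C); rewrite sqrrB; lra.
pose s := inf [set J f | f in M].
have infJ : has_inf [set J f | f in M].
  by split; [exists (J 0), 0|exists (- C ^+ 2) => _ [f _ <-]].
have sJ f : M f -> s <= J f.
  by move=> Mf; apply: ge_inf; [case: infJ|exists f].
have /boolp.choice[u uP] : forall n, exists f, M f /\ J f < s + n.+1%:R^-1.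
  move=> n; have n0 : 0 < n.+1%:R^-1 :> R by rewrite invr_gt0.
  by have [_ [f Mf <-] fs] := inf_adherent n0 infJ; exists f.
have Mu n : M (u n) by case: (uP n).
have Ju n : J (u n) < s + n.+1%:R^-1 by case: (uP n).
(* The midpoint of [f] and [g] lies in [M], so [J] is at least [s] there. In
   [2 * J f + 2 * J g - 4 * J midpoint] the terms in [l] cancel and [|f - g| ^+ 2] remains. *)
have parallelogram f g : M f -> M g ->
    `|f - g| ^+ 2 <= 2 * (J f - s) + 2 * (J g - s).
  move=> Mf Mg.
  have Mfg : M (2^-1 *: f + (2^-1 *: g + 0)) by do 2!apply: (Mlin) => //.
  have := sJ _ Mfg; rewrite addr0 /J !lD !lZ !dot_normD dotZl dotZr !normrZ.
  rewrite -[- g]scaleN1r dotZr normrZ normrN1 !exprMn.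
  rewrite (@ger0_norm _ 2^-1)//; lra.
have u_cvg : cvg (u @ \oo).
  apply/cauchy_cvgP/cauchy_exP => e e0.
  (* Both excesses over [s] will be below [e ^+ 2 / 4]; the parallelogram bound doubles and adds
     them. *)
  have e2 : 0 < e ^+ 2 / 4 by rewrite divr_gt0// exprn_gt0.
  have [N _ NP] := near_infty_natSinv_lt (PosNum e2).
  exists (u N); exists N => // n /= Nn; rewrite -ball_normE /ball_ /=.
  rewrite -(@ltr_pXn2r _ 2)// ?nnegrE ?(ltW e0)//.
  apply: (le_lt_trans (parallelogram _ _ (Mu N) (Mu n))).
  have eN : N.+1%:R^-1 < e ^+ 2 / 4 by exact: NP (leqnn N).
  have en : n.+1%:R^-1 < e ^+ 2 / 4 by exact: NP n Nn.
  (* [lra] needs the non-linear subterms to be generalised. *)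
  move: eN en (Ju N) (Ju n).
  move: (N.+1%:R^-1) (n.+1%:R^-1) (J _) (J _) (e ^+ 2) => a b a' b' c.
  lra.
exists (lim (u @ \oo)); first exact: (Mcl u).
move=> f Mf; set m := lim _; pose c := dot m f - l f.
(* First-order condition: the expression is [J (m + t *: f) - J m]. The choice of [t] below makes it
   a negative multiple of [c ^+ 2], so [c = 0]; the 1 in the denominator covers [f = 0]. *)
suff c0 t : 0 <= 2 * t * c + t ^+ 2 * `|f| ^+ 2.
  have F0 : 0 < `|f| ^+ 2 + 1 by rewrite ltr_wpDl// sqr_ge0.
  have := c0 (- c / (`|f| ^+ 2 + 1)).
  have -> : 2 * (- c / (`|f| ^+ 2 + 1)) * c +
      (- c / (`|f| ^+ 2 + 1)) ^+ 2 * `|f| ^+ 2 =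
      - (c ^+ 2 * (`|f| ^+ 2 + 2) / (`|f| ^+ 2 + 1) ^+ 2).
    by field; rewrite gt_eqF.
  rewrite oppr_ge0 pmulr_lle0 ?invr_gt0 ?exprn_gt0// pmulr_lle0; last first.
    by rewrite ltr_wpDl ?sqr_ge0.
  move=> c2; have /eqP : c ^+ 2 == 0 by rewrite eq_le c2 sqr_ge0.
  by move/eqP; rewrite sqrf_eq0 subr_eq0 => /eqP; rewrite dotC.
(* [F n] is [J (t *: f + u n) - J (u n)] plus the error term [n.+1%:R^-1], hence nonnegative since
   [u n] is minimising up to that error. Passing to the limit here only requires convergence of
   [dot (u n) f]. *)
pose F n := 2 * t * (dot (u n) f - l f) + t ^+ 2 * `|f| ^+ 2 + n.+1%:R^-1.
have F_ge0 n : 0 <= F n.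
  have := sJ _ (Mlin t _ _ Mf (Mu n)); have := Ju n; rewrite /F /J.
  rewrite llin dot_normD dotZl normrZ exprMn real_normK ?num_real// (dotC (u n)).
  move: (n.+1%:R^-1) (dot f (u n)) (l f) (l (u n)) => a b b' d.
  move: (`|f| ^+ 2) (`|u n| ^+ 2) => {}F U.
  lra.
have F_cvg : F @ \oo --> 2 * t * c + t ^+ 2 * `|f| ^+ 2.
  rewrite -[_ + _]addr0; apply: cvgD; last exact: cvg_harmonic.
  apply: cvgD; last exact: cvg_cst.
  apply: cvgM; first exact: cvg_cst.
  by apply: cvgB; [exact: cvg_dotl|exact: cvg_cst].
rewrite -(cvg_lim _ F_cvg)//; apply: limr_ge; last exact: nearW.
by apply/cvg_ex; exists (2 * t * c + t ^+ 2 * `|f| ^+ 2).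
Qed.

Lemma riesz (l : {linear V -> R^o}) : continuous l ->
  exists m, forall f, l f = dot f m.
Proof.
move=> /linear_bounded_continuous/linear_boundedP [C [_ lC]].
(* [linear_boundedP] gives the bound for every constant strictly above [C], hence for [C + 1]. *)
have [|||||m _ lm] := @riesz_subspace setT l (C + 1) => //.
- by move=> a u v; rewrite linearP.
- by apply: lC; rewrite ltrDl.
by exists m => f; exact: lm.
Qed.

End hilbert.

(** * Integrals of bounded measurable functions against finite measures *)

Section bounded_integrals.
Context d (T : measurableType d) (R : realType).
Implicit Types (mu : {measure set T -> \bar R}) (f g : T -> R).

Lemma bounded_integrable mu f : (mu [set: T] < +oo)%E ->
  measurable_fun [set: T] f -> (exists M : R, forall x, `|f x| <= M) ->
  mu.-integrable [set: T] (EFin \o f).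
Proof.
move=> muoo mf [M fM]; apply: measurable_bounded_integrable => //.
exists M; split; first exact: num_real.
by move=> y My x _; exact: le_trans (fM x) (ltW My).
Qed.

Lemma Rintegral_measure_add mu1 mu2 f :
  mu1.-integrable [set: T] (EFin \o f) -> mu2.-integrable [set: T] (EFin \o f) ->
  \int[measure_add mu1 mu2]_x f x = \int[mu1]_x f x + \int[mu2]_x f x.
Proof.
move=> i1 i2; rewrite /Rintegral integral_measure_add//.
by rewrite fineD//; exact: integrable_fin_num.
Qed.

Lemma Rintegral_le_bound mu f M : (mu [set: T] < +oo)%E ->
  measurable_fun [set: T] f -> (forall x, `|f x| <= M) ->
  `|\int[mu]_x f x| <= M * fine (mu [set: T]).
Proof.
move=> muoo mf fM.
have intf : mu.-integrable setT (EFin \o f).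
  by apply: bounded_integrable => //; exists M.
rewrite (le_trans (le_normr_Rintegral _ intf))// -Rintegral_cst//.
apply: le_Rintegral => //; first exact: integrable_norm.
by apply: bounded_integrable => //; exists `|M|.
Qed.

Lemma Rintegral_mscale (r : {nonneg R}) mu f :
  mu.-integrable [set: T] (EFin \o f) ->
  \int[mscale r mu]_x f x = r%:num * \int[mu]_x f x.
Proof.
move=> intf; have mf := measurable_int _ intf.
have mp := measurable_funepos mf; have mn := measurable_funeneg mf.
rewrite /Rintegral integralE !ge0_integral_mscale//= -muleBr//; last first.
  exact/fin_num_adde_defr/integrable_pos_fin_num.
by rewrite -integralE fineM//; exact: integrable_fin_num.
Qed.

(** [P] is the fallback value of [mnormalize] for zero or infinite mass, the two cases excluded
    here. *)
Lemma mnormalizeE mu (P : probability T R) A :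
  mu [set: T] != 0%E -> (mu [set: T] < +oo)%E ->
  mnormalize mu P A = ((fine (mu [set: T]))^-1%:E * mu A)%E.
Proof.
by move=> mu0 muoo; rewrite /mnormalize (negbTE mu0) (lt_eqF muoo)/= muleC.
Qed.

Lemma Rintegral_mnormalize mu (P : probability T R) f :
  mu [set: T] != 0%E -> (mu [set: T] < +oo)%E ->
  mu.-integrable [set: T] (EFin \o f) ->
  \int[mnormalize mu P]_x f x = (fine (mu [set: T]))^-1 * \int[mu]_x f x.
Proof.
move=> mu0 muoo intf.
have r0 : 0 <= (fine (mu [set: T]))^-1 by rewrite invr_ge0 fine_ge0.
rewrite -(Rintegral_mscale (NngNum r0))//; congr fine.
apply: eq_measure_integral => A _ _.
exact: mnormalizeE.
Qed.

End bounded_integrals.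

(** * Integration against a signed measure *)

Section charge_integral.
Context d (T : measurableType d) (R : realType).
Variable nu : {charge set T -> \bar R}.
Implicit Types (f g : T -> R).

Let posoo : (charge_pos nu [set: T] < +oo)%E.
Proof. by rewrite -ge0_fin_numE// fin_num_measure. Qed.

Let negoo : (charge_neg nu [set: T] < +oo)%E.
Proof. by rewrite -ge0_fin_numE// fin_num_measure. Qed.

(** Any decomposition into finite measures computes the integral, not only the Jordan one:
    [charge_pos nu + n] and [p + charge_neg nu] are the same measure. *)
Lemma charge_integralE (p n : {measure set T -> \bar R}) f :
  (p [set: T] < +oo)%E -> (n [set: T] < +oo)%E ->
  (forall A, measurable A -> nu A = p A - n A)%E ->
  measurable_fun [set: T] f -> (exists M : R, forall x, `|f x| <= M) ->
  charge_integral nu f = \int[p]_x f x - \int[n]_x f x.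
Proof.
move=> poo noo nuE mf bf; rewrite /charge_integral.
apply/eqP; rewrite subr_eq addrAC -subr_eq opprK; apply/eqP.
rewrite -!Rintegral_measure_add//; try exact: bounded_integrable.
congr fine; apply: eq_measure_integral => A mA _.
rewrite [LHS]measure_addE [RHS]measure_addE.
have := nuE A mA; rewrite charge_jordanE//.
(* Terms can be moved across the equation once all four values are known to be real numbers. *)
have fin (m : {measure set T -> \bar R}) : (m setT < +oo)%E ->
    exists r : R, m A = r%:E.
  move=> moo; exists (fine (m A)); rewrite fineK// ge0_fin_numE//.
  by apply: le_lt_trans moo; apply: le_measure; rewrite ?inE.
have [a pa] := fin _ posoo; have [b nb] := fin _ negoo.
have [a' pa'] := fin _ poo; have [b' nb'] := fin _ noo.
rewrite pa nb pa' nb' -!EFinB => -[ab].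
have : (a%:E + b'%:E = a'%:E + b%:E)%E by rewrite -!EFinD; congr EFin; lra.
by rewrite -pa -nb -pa' -nb'.
Qed.

Lemma charge_integrable_bounded f :
  measurable_fun [set: T] f -> (exists M : R, forall x, `|f x| <= M) ->
  charge_integrable nu f.
Proof.
move=> mf bf; apply: bounded_integrable => //.
by rewrite /charge_variation lte_add_pinfty.
Qed.

Lemma charge_integral_linear a f g :
  measurable_fun [set: T] f -> (exists M : R, forall x, `|f x| <= M) ->
  measurable_fun [set: T] g -> (exists M : R, forall x, `|g x| <= M) ->
  charge_integral nu (fun x => a * f x + g x) =
  a * charge_integral nu f + charge_integral nu g.
Proof.
move=> mf bf mg [N gN]; rewrite /charge_integral.
have baf : exists M : R, forall x, `|a * f x| <= M.
  by have [M fM] := bf; exists (`|a| * M) => x; rewrite normrM ler_wpM2l.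
have maf : measurable_fun [set: T] (fun x => a * f x) by exact: measurable_funM.
have bg : exists M : R, forall x, `|g x| <= M by exists N.
rewrite !RintegralD//; try exact: bounded_integrable.
rewrite !RintegralZl//; try exact: bounded_integrable.
by ring.
Qed.

(** [K] is the total variation of [nu]. It is chosen before [f], so that integration against [nu]
    becomes a bounded form on the RKHS. *)
Lemma charge_integral_bound : exists K, forall f M,
  measurable_fun [set: T] f -> (forall x, `|f x| <= M) ->
  `|charge_integral nu f| <= M * K.
Proof.
exists (fine (charge_pos nu setT) + fine (charge_neg nu setT)) => f M mf fM.
rewrite (le_trans (ler_normB _ _))// mulrDr lerD//; exact: Rintegral_le_bound.
Qed.

End charge_integral.

(** * Fubini for products of functions of one variable each *)

Section product_integral.
Context d1 d2 (T1 : measurableType d1) (T2 : measurableType d2) (R : realType).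

Lemma measurable_bounded_prod (f1 : T1 -> R) (f2 : T2 -> R) :
  measurable_fun [set: T1] f1 -> (exists M : R, forall x, `|f1 x| <= M) ->
  measurable_fun [set: T2] f2 -> (exists M : R, forall x, `|f2 x| <= M) ->
  measurable_fun [set: T1 * T2] (fun z => f1 z.1 * f2 z.2) /\
  exists M : R, forall z : T1 * T2, `|f1 z.1 * f2 z.2| <= M.
Proof.
move=> mf1 [M1 fM1] mf2 [M2 fM2]; split.
  by apply: measurable_funM; apply: measurableT_comp.
by exists (M1 * M2) => z; rewrite normrM ler_pM.
Qed.

Lemma product_measure_lty (m1 : {finite_measure set T1 -> \bar R})
    (m2 : {finite_measure set T2 -> \bar R}) :
  ((m1 \x m2)%E [set: T1 * T2] < +oo)%E.
Proof.
by rewrite -setXTT product_measure1E// ltey_eq fin_numM//; exact: fin_num_measure.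
Qed.

Lemma Rintegral_prod (m1 : {finite_measure set T1 -> \bar R})
    (m2 : {finite_measure set T2 -> \bar R}) (f1 : T1 -> R) (f2 : T2 -> R) :
  measurable_fun [set: T1] f1 -> (exists M : R, forall x, `|f1 x| <= M) ->
  measurable_fun [set: T2] f2 -> (exists M : R, forall x, `|f2 x| <= M) ->
  \int[(m1 \x m2)%E]_z (f1 z.1 * f2 z.2) = \int[m1]_x f1 x * \int[m2]_y f2 y.
Proof.
move=> mf1 bf1 mf2 bf2.
have i2 : m2.-integrable [set: T2] (EFin \o f2).
  by apply: bounded_integrable => //; rewrite -ge0_fin_numE// fin_num_measure.
have i1 : m1.-integrable [set: T1] (EFin \o f1).
  by apply: bounded_integrable => //; rewrite -ge0_fin_numE// fin_num_measure.
have [mf bf] := measurable_bounded_prod mf1 bf1 mf2 bf2.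
rewrite /Rintegral -(@integral12_prod_meas1 _ _ _ _ _ m1 m2); last first.
  apply: bounded_integrable => //; exact: product_measure_lty.
rewrite -fineM; [|exact: integrable_fin_num..].
congr fine.
(* The second integral is exhibited as a real constant, which can be pulled into the outer
   integral. *)
rewrite -[X in (_ * X)%E](@fineK _ (\int[m2]_x (f2 x)%:E)); last first.
  exact: integrable_fin_num.
rewrite -integralZr//; apply: eq_integral => x _.
rewrite fineK; last exact: integrable_fin_num.
by rewrite -integralZl//; apply: eq_integral => y _; rewrite -EFinM.
Qed.

(** The four products of Jordan parts are grouped by sign into two finite measures;
    [charge_integralE] avoids comparing these with the Jordan parts of [prod_charge]. *)
Lemma charge_integral_prod (nu1 : {charge set T1 -> \bar R})
    (nu2 : {charge set T2 -> \bar R}) (f1 : T1 -> R) (f2 : T2 -> R) :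
  measurable_fun [set: T1] f1 -> (exists M : R, forall x, `|f1 x| <= M) ->
  measurable_fun [set: T2] f2 -> (exists M : R, forall x, `|f2 x| <= M) ->
  charge_integral (prod_charge nu1 nu2) (fun z => f1 z.1 * f2 z.2) =
  charge_integral nu1 f1 * charge_integral nu2 f2.
Proof.
move=> mf1 bf1 mf2 bf2.
have [mf bf] := measurable_bounded_prod mf1 bf1 mf2 bf2.
have i (m1 : {finite_measure set T1 -> \bar R})
    (m2 : {finite_measure set T2 -> \bar R}) :
    (m1 \x m2)%E.-integrable setT (EFin \o (fun z => f1 z.1 * f2 z.2)).
  by apply: bounded_integrable => //; exact: product_measure_lty.
rewrite (@charge_integralE _ _ _ _
  (measure_add (charge_pos nu1 \x charge_pos nu2)%E
               (charge_neg nu1 \x charge_neg nu2)%E)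
  (measure_add (charge_pos nu1 \x charge_neg nu2)%E
               (charge_neg nu1 \x charge_pos nu2)%E))//.
- rewrite (Rintegral_measure_add (i _ _) (i _ _)).
  rewrite (Rintegral_measure_add (i _ _) (i _ _)).
  transitivity
    (\int[charge_pos nu1]_x f1 x * \int[charge_pos nu2]_x f2 x +
     \int[charge_neg nu1]_x f1 x * \int[charge_neg nu2]_x f2 x -
     (\int[charge_pos nu1]_x f1 x * \int[charge_neg nu2]_x f2 x +
      \int[charge_neg nu1]_x f1 x * \int[charge_pos nu2]_x f2 x)).
    by congr (_ + _ - (_ + _)); exact: Rintegral_prod.
  by rewrite /charge_integral; ring.
- by rewrite [X in (X < _)%E]measure_addE lte_add_pinfty// product_measure_lty.
- by rewrite [X in (X < _)%E]measure_addE lte_add_pinfty// product_measure_lty.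
- by move=> A mA; rewrite [X in (_ = X - _)%E]measure_addE
    [X in (_ = _ - X)%E]measure_addE.
Qed.

End product_integral.

(** * The kernel embedding in the RKHS of a bounded measurable kernel *)

Section rkhs_embedding.
Context (R : realType) d (X : measurableType d) (k : X -> X -> R) (H : rkhs k).
Hypothesis k_bounded : kernel_bounded k.
Hypothesis k_measurable : kernel_measurable k.

Local Notation dot := (rkhs_dot H).
Local Notation eval := (rkhs_eval H).
Local Notation feature := (rkhs_feature H).

Let normE := @rkhs_normE _ _ _ H.

Lemma rkhs_dotC (f g : H) : dot f g = dot g f.
Proof. by rewrite (@hermC _ false) expr0 mul1r. Qed.

Lemma rkhs_feature_bounded : exists M, forall x, `|feature x| <= M.
Proof.
(* The squared norm of a feature is [k x x], at most [M]; [1 + M] bounds its square root because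
   [2 * a <= 1 + a ^+ 2]. *)
have [M kM] := k_bounded; exists (1 + M) => x.
have : `|feature x| ^+ 2 <= M.
  rewrite normE -rkhs_reproducing rkhs_featureE.
  exact: le_trans (ler_norm _) (kM x x).
have := sqr_ge0 (`|feature x| - 1); rewrite sqrrB1.
move: (normr_ge0 (feature x)); move: (`|feature x|) => a; lra.
Qed.

Lemma rkhs_eval_le : exists M, forall h x, `|eval h x| <= M * `|h|.
Proof.
have [M fM] := rkhs_feature_bounded; exists M => h x.
rewrite rkhs_reproducing (le_trans (cauchy_schwarz normE _ _))// mulrC.
exact: ler_wpM2r.
Qed.

Lemma rkhs_eval_bounded h : exists M : R, forall x, `|eval h x| <= M.
Proof. by have [M fM] := rkhs_eval_le; exists (M * `|h|). Qed.

Let measurable_feature x : measurable_fun [set: X] (eval (feature x)).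
Proof.
rewrite rkhs_featureE.
exact: (measurableT_comp k_measurable (pair2_measurable x)).
Qed.

(* The functions of the RKHS that are measurable form a closed subspace which
   contains the features, so the projection of [h] onto it has the same inner
   products with the features as [h], hence is [h]. *)
Lemma measurable_rkhs_eval h : measurable_fun [set: X] (eval h).
Proof.
pose M : set H := [set f | measurable_fun [set: X] (eval f)].
have [|||||m Mm hm] := @riesz_subspace _ _ _ normE M (dot ^~ h) `|h|.
- by rewrite /M /= linear0; exact: measurable_cst.
- move=> a u v Mu Mv; rewrite /M/= linearP.
  apply: measurable_funD => //.
  by apply: measurable_funM.
- move=> u v Mu uv; apply: (measurable_fun_cvg Mu) => x _.
  rewrite rkhs_reproducing; under eq_fun do rewrite rkhs_reproducing.
  exact: (cvg_dotl normE).
- by move=> a u v; rewrite linearPl.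
- by move=> v; rewrite (le_trans (cauchy_schwarz normE _ _))// mulrC.
suff -> : h = m by [].
apply: (@rkhs_eval_inj _ _ _ H); apply/funext => x.
rewrite (rkhs_reproducing h) (rkhs_reproducing m).
rewrite (rkhs_dotC h) (rkhs_dotC m); apply: hm; exact: measurable_feature.
Qed.

(** By Riesz, every continuous linear form is [dot ^~ m] for some [m], and its composition with
    [feature] is [eval m]. This function is bounded and measurable, so integrability holds
    automatically. *)
Lemma pettis_integralP (nu : {charge set X -> \bar R}) (h : H) :
  is_pettis_integral nu feature h <->
  forall f, dot f h = charge_integral nu (eval f).
Proof.
have evalE f : dot_form dot f \o feature = eval f.
  by apply/funext => x; rewrite rkhs_reproducing.
split=> [hP f|hP l lc].
  have [_] := hP (dot_form dot f) (@dot_form_continuous _ _ _ normE f).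
  by rewrite evalE.
have [m lm] := riesz normE lc.
have -> : l \o feature = eval m.
  by apply/funext => x; rewrite /= lm rkhs_reproducing rkhs_dotC.
split; last by rewrite lm rkhs_dotC hP.
apply: charge_integrable_bounded; first exact: measurable_rkhs_eval.
exact: rkhs_eval_bounded.
Qed.

(** It is the Riesz representative of integration against [nu], a form bounded by [M * K]: [M] from
    evaluation, [K] from the total variation. *)
Lemma pettis_integral_exists (nu : {charge set X -> \bar R}) :
  exists h : H, is_pettis_integral nu feature h.
Proof.
have [M evalM] := rkhs_eval_le.
have [K intK] := charge_integral_bound nu.
have [|||||h _ hP] :=
  @riesz_subspace _ _ _ normE setT (charge_integral nu \o eval) (M * K) => //.
- move=> a u v /=; rewrite linearP -charge_integral_linear//;
    by [exact: measurable_rkhs_eval|exact: rkhs_eval_bounded].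
- move=> v /=; rewrite mulrAC; apply: intK => //.
  exact: measurable_rkhs_eval.
by exists h; apply/pettis_integralP => f; rewrite -hP.
Qed.

Lemma dot_kernel_embedding (nu : {charge set X -> \bar R}) (f : H) :
  dot f (kernel_embedding H nu) = charge_integral nu (eval f).
Proof.
apply: (pettis_integralP nu _).1; have [h hP] := pettis_integral_exists nu.
exact: (@xgetPex _ 0 [set h : H | is_pettis_integral nu feature h]
  (ex_intro _ h hP)).
Qed.

Lemma eval_kernel_embedding (nu : {charge set X -> \bar R}) x :
  eval (kernel_embedding H nu) x = charge_integral nu (k ^~ x).
Proof. by rewrite rkhs_reproducing rkhs_dotC dot_kernel_embedding rkhs_featureE. Qed.

Lemma embedding_norm_sqr (nu : {charge set X -> \bar R}) :
  embedding_norm H nu ^+ 2 = charge_integral nu (eval (kernel_embedding H nu)).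
Proof. by rewrite /embedding_norm normE dot_kernel_embedding. Qed.

Lemma embedding_norm_eq0 (nu : {charge set X -> \bar R}) :
  embedding_norm H nu = 0 -> forall f, charge_integral nu (eval f) = 0.
Proof.
by move=> /normr0_eq0 nu0 f; rewrite -dot_kernel_embedding nu0 linear0r.
Qed.

Lemma characteristic_mass0 (nu : {charge set X -> \bar R}) :
  characteristic_kernel H -> nu [set: X] = 0%E -> embedding_norm H nu = 0 ->
  is_zero_charge nu.
Proof.
move=> char nuT nu0 A mA.
pose p := charge_pos nu; pose n := charge_neg nu.
have poo : (p setT < +oo)%E by rewrite -ge0_fin_numE// fin_num_measure.
have noo : (n setT < +oo)%E by rewrite -ge0_fin_numE// fin_num_measure.
have pn : p setT = n setT.
  move: nuT; rewrite charge_jordanE// -/p -/n => /eqP.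
  by rewrite sube_eq ?fin_num_measure// ?fin_num_adde_defl ?fin_num_measure//
    add0e => /eqP.
rewrite charge_jordanE//.
(* If the common mass of the two parts is zero they cannot be normalised, but then both vanish. *)
have [pT0|pT0] := eqVneq (p setT) 0%E.
  have le0 (m : {finite_measure set X -> \bar R}) : m setT = 0%E -> m A = 0%E.
    move=> m0; apply/eqP; rewrite eq_le measure_ge0 andbT -m0.
    by rewrite le_measure ?inE.
  by rewrite !le0 ?sube0// -pn.
(* A point is needed for the fallback [dirac x] of [mnormalize]; nonzero mass provides one. *)
have [x _] : exists x : X, True.
  apply/not_existsP => X0; move/eqP : pT0; apply.
  suff -> : [set: X] = set0 by rewrite measure0.
  by apply/seteqP; split => // x; have := X0 x.
pose P : probability X R := mnormalize p (dirac x).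
pose Q : probability X R := mnormalize n (dirac x).
have nT0 : n [set: X] != 0%E by rewrite -pn.
have PQ : kernel_embedding H (charge_of_finite_measure P) =
          kernel_embedding H (charge_of_finite_measure Q).
  apply: (dot_ext normE) => f; rewrite !dot_kernel_embedding.
  have mf := measurable_rkhs_eval f; have bf := rkhs_eval_bounded f.
  have probE (S : probability X R) :
      charge_integral (charge_of_finite_measure S) (eval f) = \int[S]_x eval f x.
    rewrite (@charge_integralE _ _ _ _ S mzero)//.
    - by rewrite [X in _ - X]/Rintegral integral_measure_zero subr0.
    - by rewrite -ge0_fin_numE// fin_num_measure.
    - by rewrite /mzero ltry.
    - by move=> B mB; rewrite /mzero sube0.
  (* Both integrals carry the same factor, the inverse of the common mass; what remains is the
     integral of [eval f] against [nu], zero since the embedding of [nu] is. *)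
  rewrite !probE !Rintegral_mnormalize//; try exact: bounded_integrable.
  congr (_ * _); first exact: (congr1 (fun t => (fine t)^-1) pn).
  apply/eqP; rewrite -subr_eq0; apply/eqP.
  exact: embedding_norm_eq0.
have fp : p A \is a fin_num by rewrite fin_num_measure.
have fn : n A \is a fin_num by rewrite fin_num_measure.
have PE : P A = ((fine (p setT))^-1%:E * p A)%E by exact: mnormalizeE.
have QE : Q A = ((fine (p setT))^-1%:E * n A)%E.
  by rewrite pn; exact: mnormalizeE.
have m0 : (fine (p setT))^-1 != 0.
  by rewrite invr_neq0// fine_eq0// ge0_fin_numE.
have := char P Q PQ A mA; rewrite PE QE -[p A]fineK// -[n A]fineK// -!EFinM.
move=> -[/(mulfI m0) pnA].
have -> : charge_pos nu A = charge_neg nu A by rewrite -[LHS]fineK// pnA fineK.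
by rewrite subee// fin_num_measure.
Qed.

End rkhs_embedding.

(** * The product kernel and the product formula *)

Section product_kernel.
Context (R : realType) d1 d2 (X1 : measurableType d1) (X2 : measurableType d2).
Variables (k1 : X1 -> X1 -> R) (k2 : X2 -> X2 -> R).
Hypotheses (k1_bounded : kernel_bounded k1) (k1_measurable : kernel_measurable k1).
Hypotheses (k2_bounded : kernel_bounded k2) (k2_measurable : kernel_measurable k2).

Lemma prod_kernel_bounded : kernel_bounded (prod_kernel k1 k2).
Proof.
have [M1 kM1] := k1_bounded; have [M2 kM2] := k2_bounded.
by exists (M1 * M2) => x y; rewrite normrM ler_pM.
Qed.

Lemma prod_kernel_measurable : kernel_measurable (prod_kernel k1 k2).
Proof.
have m1 : measurable_fun [set: (X1 * X2) * (X1 * X2)] (fun z => (z.1.1, z.2.1)).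
  by apply/measurable_fun_pair; apply: measurableT_comp.
have m2 : measurable_fun [set: (X1 * X2) * (X1 * X2)] (fun z => (z.1.2, z.2.2)).
  by apply/measurable_fun_pair; apply: measurableT_comp.
by apply: measurable_funM;
  [exact: (measurableT_comp k1_measurable m1)|
   exact: (measurableT_comp k2_measurable m2)].
Qed.

Variables (H1 : rkhs k1) (H2 : rkhs k2) (H : rkhs (prod_kernel k1 k2)).

Lemma embedding_norm_prod (mu1 : {charge set X1 -> \bar R})
    (mu2 : {charge set X2 -> \bar R}) :
  embedding_norm H (prod_charge mu1 mu2) =
  embedding_norm H1 mu1 * embedding_norm H2 mu2.
Proof.
have kb := prod_kernel_bounded; have km := prod_kernel_measurable.
have section1 x : measurable_fun [set: X1] (k1 ^~ x).
  exact: (measurableT_comp k1_measurable (pair2_measurable x)).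
have section2 x : measurable_fun [set: X2] (k2 ^~ x).
  exact: (measurableT_comp k2_measurable (pair2_measurable x)).
have bound1 x : exists M : R, forall y, `|k1 y x| <= M.
  by have [M kM] := k1_bounded; exists M.
have bound2 x : exists M : R, forall y, `|k2 y x| <= M.
  by have [M kM] := k2_bounded; exists M.
(* Norms are nonnegative, so their squares, which are integrals of the embeddings, may be
   compared. *)
apply/eqP; rewrite -(@eqrXn2 _ 2)// ?mulr_ge0//; try exact: normr_ge0.
rewrite exprMn (embedding_norm_sqr _ k1_bounded)//.
rewrite (embedding_norm_sqr _ k2_bounded)//.
rewrite (embedding_norm_sqr _ kb km) -charge_integral_prod; first last.
- exact: rkhs_eval_bounded.
- exact: measurable_rkhs_eval.
- exact: rkhs_eval_bounded.
- exact: measurable_rkhs_eval.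
(* It remains to see that the embedding of the product charge is pointwise the product of the
   embeddings. Its value at [z] integrates a section of the product kernel, which factorises, so
   Fubini applies a second time. *)
apply/eqP; congr charge_integral; apply/funext => z.
rewrite (eval_kernel_embedding _ kb km).
rewrite (eval_kernel_embedding _ k1_bounded)//.
rewrite (eval_kernel_embedding _ k2_bounded)//.
exact: charge_integral_prod.
Qed.

(** Mass and norm enter through products, so that the null-mass factor may stand on either side. If
    neither charge were zero, some rectangle would have nonzero product charge. *)
Lemma characteristic_prod_charge0 (mu1 : {charge set X1 -> \bar R})
    (mu2 : {charge set X2 -> \bar R}) :
  characteristic_kernel H -> (mu1 [set: X1] * mu2 [set: X2] = 0)%E ->
  embedding_norm H1 mu1 * embedding_norm H2 mu2 = 0 ->
  is_zero_charge mu1 \/ is_zero_charge mu2.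
Proof.
move=> char mass0 norm0.
have mu0 : is_zero_charge (prod_charge mu1 mu2).
  apply: (characteristic_mass0 prod_kernel_bounded prod_kernel_measurable char).
    by rewrite -setXTT prod_chargeE.
  by rewrite embedding_norm_prod.
apply: contrapT => /not_orP[].
move=> /existsNP[A /not_implyP[mA A0]] /existsNP[B /not_implyP[mB B0]].
have /eqP := mu0 _ (measurableX mA mB); rewrite prod_chargeE// mule_eq0.
by move=> /orP[] /eqP.
Qed.

End product_kernel.

(** * Charges of total mass zero and strict positive definiteness *)

Lemma exists_null_mass_charge (R : realType) d (X : measurableType d) :
  charge_dim_ge R X 2 ->
  exists2 nu : {charge set X -> \bar R}, nu [set: X] = 0%E & ~ is_zero_charge nu.
Proof.
move=> [nu free].
have fin i : nu i setT \is a fin_num by rewrite fin_num_measure.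
pose a := fine (nu ord0 setT); pose b := fine (nu ord_max setT).
have aE : nu ord0 setT = a%:E by rewrite fineK.
have bE : nu ord_max setT = b%:E by rewrite fineK.
have comb s t : (s, t) != (0, 0) ->
    ~ is_zero_charge (cadd (cscale s (nu ord0)) (cscale t (nu ord_max))).
  move=> st0 nu0.
  have c0 : forall i : 'I_2, (if i == ord0 then s else t) = 0.
    apply: (free (fun i : 'I_2 => if i == ord0 then s else t)) => A mA.
    rewrite big_ord_recl big_ord1/=.
    by have := nu0 A mA; rewrite /cadd /cscale/=; congr (_ + _ * nu _ A = _)%E;
      apply: val_inj.
  move/negP: st0; apply; apply/eqP; congr pair; first exact: (c0 ord0).
  exact: (c0 ord_max).
have massE s t : cadd (cscale s (nu ord0)) (cscale t (nu ord_max)) setT =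
    (s * a + t * b)%:E.
  by rewrite EFinD !EFinM -aE -bE.
(* If both masses vanish, the first charge will do. Otherwise the coefficients [b] and [- a] are not
   both zero and cancel the total mass. *)
have [[a0 b0]|ab] := pselect (a = 0 /\ b = 0).
  exists (cadd (cscale 1 (nu ord0)) (cscale 0 (nu ord_max))).
    by rewrite [LHS]massE a0 b0 !mulr0 addr0.
  by apply: comb; rewrite xpair_eqE oner_eq0.
exists (cadd (cscale b (nu ord0)) (cscale (- a) (nu ord_max))).
  by rewrite [LHS]massE mulNr mulrC subrr.
apply: comb; rewrite xpair_eqE oppr_eq0; apply/negP => /andP[/eqP b0 /eqP a0].
exact: ab.
Qed.

(** The double integral is the squared norm, so only definiteness of the norm is at stake. Symmetry
    of [k] is used because the embedding at [x] integrates [k ^~ x], whereas the double integral has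
    [k x] inside. *)
Lemma strictly_integrally_pdP (R : realType) d (X : measurableType d)
    (k : X -> X -> R) (H : rkhs k) (M : set (charge X R)) :
  kernel_bounded k -> kernel_measurable k -> (forall x y, k x y = k y x) ->
  (forall nu, M nu -> embedding_norm H nu = 0 -> is_zero_charge nu) ->
  strictly_integrally_pd H M.
Proof.
move=> kb km ksym inj nu Mnu nu0.
have normE : embedding_norm H nu ^+ 2 =
    charge_integral nu (fun x => charge_integral nu (fun x' => k x x')).
  rewrite embedding_norm_sqr//; congr charge_integral; apply/funext => x.
  by rewrite eval_kernel_embedding//; congr charge_integral; apply/funext.
rewrite -normE; split=> //; rewrite exprn_gt0// lt_neqAle normr_ge0 andbT eq_sym.
by apply/eqP => norm0; apply: nu0; exact: inj.
Qed.

Theorem lemma3p4 (R : realType) (d1 d2 : measure_display)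
    (X1 : measurableType d1) (X2 : measurableType d2)
    (k1 : X1 -> X1 -> R) (k2 : X2 -> X2 -> R)
    (k1_kernel : pd_kernel k1) (k1_bounded : kernel_bounded k1)
    (k1_measurable : kernel_measurable k1)
    (k2_kernel : pd_kernel k2) (k2_bounded : kernel_bounded k2)
    (k2_measurable : kernel_measurable k2)
    (H1 : rkhs k1) (H2 : rkhs k2) (H : rkhs (prod_kernel k1 k2)) :
  (forall (mu1 : {charge set X1 -> \bar R}) (mu2 : {charge set X2 -> \bar R}),
     embedding_norm H (prod_charge mu1 mu2) =
     embedding_norm H1 mu1 * embedding_norm H2 mu2) /\
  (charge_dim_ge R X1 2 -> charge_dim_ge R X2 2 -> characteristic_kernel H ->
     strictly_integrally_pd H1 [set: charge X1 R] /\
     strictly_integrally_pd H2 [set: charge X2 R]).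
Proof.
split=> [mu1 mu2|]; first exact: embedding_norm_prod.
move=> /exists_null_mass_charge[nu1 nu1T nu1_neq0].
move=> /exists_null_mass_charge[nu2 nu2T nu2_neq0] char.
have null := characteristic_prod_charge0 k1_bounded k1_measurable k2_bounded
  k2_measurable (H1 := H1) (H2 := H2) char.
split; apply: strictly_integrally_pdP => //;
  try by [case: k1_kernel|case: k2_kernel].
(* A charge of norm zero is paired with the null-mass charge on the other space, which is nonzero;
   hence it is itself zero. *)
- move=> nu _ nu0; have [//||//|//] := null nu nu2.
    by rewrite nu2T mule0.
  by rewrite nu0 mul0r.
- move=> nu _ nu0; have [//||//|//] := null nu1 nu.
    by rewrite nu1T mul0e.
  by rewrite nu0 mulr0.
Qed.
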